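(* Let $\mu\in(0,1/2]$ and $c<c_J$. Then the universal cover of each connected component of the regularized energy hypersurface of the Euler problem at energy $c$ is dynamically convex, i.e. every periodic Reeb orbit on it has Conley–Zehnder index at least $3$.
   Context: Fix $\mu\in(0,1/2]$, $E=(-1/2,0)$, $M=(1/2,0)$, $H(q,p)=\tfrac12|p|^2-\frac{1-\mu}{|q-E|}-\frac{\mu}{|q-M|}$ on $(\mathbb R^2\setminus\{E,M\})\times\mathbb R^2$ with $\omega=\sum dp_j\wedge dq_j$, and $c_J=-1-2\sqrt{\mu(1-\mu)}$. For $c<c_J$, $H^{-1}(c)$ has two components (one near $E$, one near $M$); each, after regularization of two-body collisions, is a closed 3-manifold diffeomorphic to $\mathbb{RP}^3$ of restricted contact type (transverse Liouville vector fields $(q-E)\partial_q$ resp. $(q-M)\partial_q$, extended over the regularization), hence carries a contact form whose Reeb flow is a reparametrization of the Hamiltonian flow. Its universal cover is $S^3$ with the pulled-back contact form (realized, e.g., as a component of $K_c^{-1}(0)$, $K_c=2p_\lambda^2-2\cosh\lambda-c\cosh^2\lambda+2p_\nu^2+2(1-2\mu)\cos\nu+c\cos^2\nu$, in doubly covered elliptic coordinates $q_1=\frac12\cosh\lambda\cos\nu$, $q_2=\frac12\sinh\lambda\sin\nu$). The Conley–Zehnder index of a periodic Reeb orbit is the Hofer–Wysocki–Zehnder index computed with a trivialization of the contact structure over a spanning disk. *)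

(* Defs.v *)
From Stdlib Require Import Reals Lra ZArith.
From Coquelicot Require Import Coquelicot.
Open Scope R_scope.

(** Points of the phase space R^4 with coordinates (lambda, nu, p_lambda, p_nu)
    (doubly covered elliptic coordinates, nu lifted to R: this is the universal
    cover picture of the regularized energy hypersurface). *)
Record pt := mkpt { lam : R; nu : R; plam : R; pnu : R }.

Definition padd (x y : pt) : pt :=
  mkpt (lam x + lam y) (nu x + nu y) (plam x + plam y) (pnu x + pnu y).
Definition pscal (s : R) (x : pt) : pt :=
  mkpt (s * lam x) (s * nu x) (s * plam x) (s * pnu x).
Definition pdot (x y : pt) : R :=
  lam x * lam y + nu x * nu y + plam x * plam y + pnu x * pnu y.

Definition cJ (mu : R) : R := -1 - 2 * sqrt (mu * (1 - mu)).

Definition Kc (mu c : R) (l n a b : R) : R :=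
  2 * a ^ 2 - 2 * cosh l - c * (cosh l) ^ 2
  + 2 * b ^ 2 + 2 * (1 - 2 * mu) * cos n + c * (cos n) ^ 2.

Definition Kpt (mu c : R) (x : pt) : R := Kc mu c (lam x) (nu x) (plam x) (pnu x).

Definition gradK (mu c : R) (x : pt) : pt :=
  mkpt (Derive (fun s => Kc mu c s (nu x) (plam x) (pnu x)) (lam x))
       (Derive (fun s => Kc mu c (lam x) s (plam x) (pnu x)) (nu x))
       (Derive (fun s => Kc mu c (lam x) (nu x) s (pnu x)) (plam x))
       (Derive (fun s => Kc mu c (lam x) (nu x) (plam x) s) (pnu x)).

(** Hamiltonian vector field of K_c for omega = dp_lam/\dlam + dp_nu/\dnu,
    oriented so that it is a positive multiple of the Reeb vector field
    (q' = dK/dp, p' = -dK/dq). *)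
Definition XK (mu c : R) (x : pt) : pt :=
  let g := gradK mu c x in mkpt (plam g) (pnu g) (- lam g) (- nu g).

Definition DXK (mu c : R) (x v : pt) : pt :=
  mkpt (Derive (fun s => lam (XK mu c (padd x (pscal s v)))) 0)
       (Derive (fun s => nu (XK mu c (padd x (pscal s v)))) 0)
       (Derive (fun s => plam (XK mu c (padd x (pscal s v)))) 0)
       (Derive (fun s => pnu (XK mu c (padd x (pscal s v)))) 0).

Definition solves (F : R -> pt -> pt) (gam : R -> pt) : Prop :=
  forall t,
    is_derive (fun s => lam (gam s)) t (lam (F t (gam t))) /\
    is_derive (fun s => nu (gam s)) t (nu (F t (gam t))) /\
    is_derive (fun s => plam (gam s)) t (plam (F t (gam t))) /\
    is_derive (fun s => pnu (gam s)) t (pnu (F t (gam t))).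

(** A T-periodic orbit (not necessarily of minimal period; multiple covers
    included) of the Hamiltonian flow on the energy level K_c^{-1}(0). *)
Definition periodic_orbit (mu c : R) (gam : R -> pt) (T : R) : Prop :=
  0 < T /\ Kpt mu c (gam 0) = 0 /\ gam T = gam 0 /\
  solves (fun _ x => XK mu c x) gam.

(** Global symplectic frame (f1, f2) of the symplectic complement of
    span(grad K, X_K), which is a subbundle of T(K^{-1}(0)) transverse to X_K
    and symplectically isomorphic to the contact structure xi:
    omega(f1,f2) = 1, f1,f2 Euclidean-orthonormal and orthogonal to grad K, X_K. *)
Definition gnorm (mu c : R) (x : pt) : R := sqrt (pdot (gradK mu c x) (gradK mu c x)).
Definition frame1 (mu c : R) (x : pt) : pt :=
  let g := gradK mu c x in
  pscal (/ gnorm mu c x) (mkpt (- pnu g) (plam g) (- nu g) (lam g)).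
Definition frame2 (mu c : R) (x : pt) : pt :=
  let g := gradK mu c x in
  pscal (/ gnorm mu c x) (mkpt (- nu g) (lam g) (pnu g) (- plam g)).

Definition winds (mu c : R) (gam : R -> pt) (T : R) (z : R * R) (w : R) : Prop :=
  exists (v : R -> pt) (theta : R -> R),
    solves (fun t u => DXK mu c (gam t) u) v /\
    v 0 = padd (pscal (fst z) (frame1 mu c (gam 0))) (pscal (snd z) (frame2 mu c (gam 0))) /\
    (forall t, 0 <= t <= T -> continuity_pt theta t) /\
    (forall t, 0 <= t <= T ->
       let x := pdot (frame1 mu c (gam t)) (v t) in
       let y := pdot (frame2 mu c (gam t)) (v t) in
       x = sqrt (x ^ 2 + y ^ 2) * cos (theta t) /\
       y = sqrt (x ^ 2 + y ^ 2) * sin (theta t)) /\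
    w = (theta T - theta 0) / (2 * PI).

(** Conley-Zehnder index in the sense of Hofer-Wysocki-Zehnder via the winding
    interval I = { winding of z | z <> 0 }:  mu_CZ = 2k if k is in I,
    and 2k+1 if I is contained in (k, k+1). *)
Definition is_CZ (mu c : R) (gam : R -> pt) (T : R) (n : Z) : Prop :=
  (exists k : Z, n = (2 * k)%Z /\
     exists z : R * R, z <> (0, 0) /\ winds mu c gam T z (IZR k)) \/
  (exists k : Z, n = (2 * k + 1)%Z /\
     forall z : R * R, z <> (0, 0) -> forall w, winds mu c gam T z w ->
       IZR k < w < IZR k + 1).

(* Main.v *)
Require Import Defs.
From Stdlib Require Import Reals ZArith Lra Lia.
From Coquelicot Require Import Coquelicot.
Open Scope R_scope.

(** [K_c] splits as [A(lam, plam) + B(nu, pnu)], and below the critical energy both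
    one-degree-of-freedom systems oscillate in a potential well.  With
    [xi = A_lam + i A_plam] and [eta = B_nu + i B_pnu], the frame coordinates of the
    Hamiltonian field of [A] alone are a positive multiple of the conjugate of
    [xi * eta].  If neither factor is at rest, this field (modulo [X_K]) is a periodic
    solution of the linearized flow; over the period each of [xi], [eta] makes a
    positive number of clockwise turns, so the winding is an integer [N1 + N2 >= 2] and
    the index is at least 4.  If one factor is at rest, the linearized flow
    in its plane is a harmonic oscillator, turning in the same direction as the frame
    does, which itself makes [N >= 1] full turns; all windings exceed 1 and the index is
    at least 3. *)

(** * Arguments of plane curves *)

(** Same shape as the angle condition in [winds], so the two convert into each other. At the origin
    every angle qualifies, the square root being zero there. *)
Definition is_arg (th x y : R) : Prop :=
  x = sqrt (x ^ 2 + y ^ 2) * cos th /\ y = sqrt (x ^ 2 + y ^ 2) * sin th.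

Lemma cos2_sin2 th : cos th ^ 2 + sin th ^ 2 = 1.
Proof. pose proof (sin2_cos2 th) as H; unfold Rsqr in H; nra. Qed.

Lemma is_arg_polar th r x y :
  0 <= r -> x = r * cos th -> y = r * sin th -> is_arg th x y.
Proof.
  intros Hr -> ->. unfold is_arg.
  replace ((r * cos th) ^ 2 + (r * sin th) ^ 2) with (r ^ 2)
    by (pose proof (cos2_sin2 th); nra).
  rewrite sqrt_pow2 by exact Hr. now split.
Qed.

Lemma is_arg_scal th s x y : 0 <= s -> is_arg th x y -> is_arg th (s * x) (s * y).
Proof.
  intros Hs [Hx Hy].
  apply is_arg_polar with (s * sqrt (x ^ 2 + y ^ 2)).
  - apply Rmult_le_pos; [exact Hs | apply sqrt_pos].
  - rewrite Rmult_assoc, <- Hx; reflexivity.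
  - rewrite Rmult_assoc, <- Hy; reflexivity.
Qed.

Lemma is_arg_mul th1 th2 x1 y1 x2 y2 :
  is_arg th1 x1 y1 -> is_arg th2 x2 y2 ->
  is_arg (th1 + th2) (x1 * x2 - y1 * y2) (x1 * y2 + y1 * x2).
Proof.
  unfold is_arg at 1 2.
  pose proof (sqrt_pos (x1 ^ 2 + y1 ^ 2)) as Hs1.
  pose proof (sqrt_pos (x2 ^ 2 + y2 ^ 2)) as Hs2.
  generalize dependent (sqrt (x1 ^ 2 + y1 ^ 2)).
  generalize dependent (sqrt (x2 ^ 2 + y2 ^ 2)).
  intros s2 Hs2 s1 Hs1 [-> ->] [-> ->].
  apply is_arg_polar with (s1 * s2).
  - now apply Rmult_le_pos.
  - rewrite cos_plus. ring.
  - rewrite sin_plus. ring.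
Qed.

Lemma is_arg_opp th x y : is_arg th x y -> is_arg (th + PI) (- x) (- y).
Proof.
  intros H.
  assert (Hpi : is_arg PI (-1) 0).
  { apply is_arg_polar with 1; [lra | rewrite cos_PI; ring | rewrite sin_PI; ring]. }
  pose proof (is_arg_mul _ _ _ _ _ _ H Hpi) as H'.
  replace (- x) with (x * -1 - y * 0) by ring.
  replace (- y) with (x * 0 + y * -1) by ring. exact H'.
Qed.

Lemma is_arg_conj th x y : is_arg th x y -> is_arg (- th) x (- y).
Proof.
  intros [Hx Hy]. apply is_arg_polar with (sqrt (x ^ 2 + y ^ 2)).
  - apply sqrt_pos.
  - now rewrite cos_neg.
  - rewrite sin_neg. lra.
Qed.

Lemma is_arg_atan x y : 0 < x -> is_arg (atan (y / x)) x y.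
Proof.
  intros Hx.
  assert (Hc : 0 < cos (atan (y / x))).
  { apply cos_gt_0; pose proof (atan_bound (y / x)); lra. }
  assert (Ht : sin (atan (y / x)) = y / x * cos (atan (y / x))).
  { rewrite <- (tan_atan (y / x)) at 2. unfold tan. field. lra. }
  apply is_arg_polar with (x / cos (atan (y / x))).
  - apply Rlt_le, Rdiv_lt_0_compat; assumption.
  - field. lra.
  - rewrite Ht. field. lra.
Qed.

Lemma exists_arg x y : exists th, is_arg th x y.
Proof.
  destruct (Rtotal_order x 0) as [H|[->|H]].
  - exists (atan (- y / - x) + PI).
    pose proof (is_arg_opp _ _ _ (is_arg_atan (- x) (- y) ltac:(lra))) as Ha.
    now rewrite !Ropp_involutive in Ha.
  - destruct (Rle_lt_dec 0 y) as [H'|H'].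
    + exists (PI / 2). apply is_arg_polar with y; [lra| |].
      * rewrite cos_PI2; ring.
      * rewrite sin_PI2; ring.
    + exists (- (PI / 2)). apply is_arg_polar with (- y); [lra| |].
      * rewrite cos_neg, cos_PI2; ring.
      * rewrite sin_neg, sin_PI2; ring.
  - exists (atan (y / x)). now apply is_arg_atan.
Qed.

(* If [(x,y)] and [(x',y')] make an acute angle, that angle is an arctangent. *)
Lemma is_arg_acute th x y x' y' :
  0 < x * x' + y * y' -> is_arg th x y ->
  is_arg (th + atan ((x * y' - y * x') / (x * x' + y * y'))) x' y'.
Proof.
  intros Hd H.
  pose proof (is_arg_mul _ _ _ _ _ _ H (is_arg_atan _ (x * y' - y * x') Hd)) as Hm.
  assert (Hr : 0 < x ^ 2 + y ^ 2).
  { destruct (Req_dec x 0) as [->|]; [destruct (Req_dec y 0) as [->|]|]; nra. }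
  apply (is_arg_scal _ (/ (x ^ 2 + y ^ 2))) in Hm.
  2:{ apply Rlt_le, Rinv_0_lt_compat, Hr. }
  match type of Hm with is_arg _ ?a ?b =>
    replace a with x' in Hm by (field; lra); replace b with y' in Hm by (field; lra) end.
  exact Hm.
Qed.

Lemma same_arg_cos th1 th2 x y :
  0 < x ^ 2 + y ^ 2 -> is_arg th1 x y -> is_arg th2 x y -> cos (th1 - th2) = 1.
Proof.
  intros Hr [Hx1 Hy1] [Hx2 Hy2]. rewrite cos_minus.
  pose proof (sqrt_lt_R0 _ Hr) as Hs. pose proof (sqrt_sqrt _ (Rlt_le _ _ Hr)) as Hss.
  set (s := sqrt (x ^ 2 + y ^ 2)) in *.
  apply (Rmult_eq_reg_l (s * s)); [|nra].
  transitivity (s * cos th1 * (s * cos th2) + s * sin th1 * (s * sin th2)); [ring|].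
  rewrite <- Hx1, <- Hx2, <- Hy1, <- Hy2. lra.
Qed.

Lemma cos_eq_1_2PI d : cos d = 1 -> exists k : Z, d = 2 * PI * IZR k.
Proof.
  intros H.
  assert (Hs : sin (d / 2) = 0).
  { replace d with (2 * (d / 2)) in H by field. rewrite cos_2a_sin in H. nra. }
  destruct (sin_eq_0_0 _ Hs) as [k Hk]. exists k. lra.
Qed.

Lemma cos_2PI_Z k : cos (2 * PI * IZR k) = 1.
Proof.
  replace (2 * PI * IZR k) with (2 * (IZR k * PI)) by ring.
  rewrite cos_2a_sin, (sin_eq_0_1 (IZR k * PI)) by eauto. ring.
Qed.

(** * Uniqueness and existence of continuous argument lifts *)

Lemma continuity_pt_minus' f g t :
  continuity_pt f t -> continuity_pt g t -> continuity_pt (fun s => f s - g s) t.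
Proof. intros Hf Hg. exact (continuity_pt_minus _ _ _ Hf Hg). Qed.

Lemma continuous_avoids_value (f : R -> R) a b y :
  a <= b -> (forall t, a <= t <= b -> continuity_pt f t) ->
  (forall t, a <= t <= b -> f t <> y) -> f a < y -> f b < y.
Proof.
  intros Hab Hc Hy Ha.
  destruct (Rlt_le_dec (f b) y) as [|Hb]; [assumption|exfalso].
  assert (Hlt : a < b).
  { destruct Hab as [|<-]; [assumption | lra]. }
  destruct (Ranalysis5.IVT_interv (fun t => f t - y) a b) as [z [Hz Hfz]].
  - intros t Ht. apply continuity_pt_minus'; [now apply Hc|].
    apply continuity_pt_const. intros ? ?; reflexivity.
  - exact Hlt.
  - lra.
  - destruct Hb as [|Hb]; [lra|]. exfalso; apply (Hy b); lra.
  - apply (Hy z Hz). lra.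
Qed.

(** The difference of the lifts is always a multiple of [2 * PI]. By continuity it cannot reach
    [2 * PI * IZR k0 + PI] or [2 * PI * IZR k0 - PI], where the cosine is [-1], so the multiple
    never changes. Hence the winding of a nowhere vanishing solution does not depend on the [theta]
    chosen in [winds]. *)
Lemma two_lifts (x y th1 th2 : R -> R) T :
  0 <= T ->
  (forall t, 0 <= t <= T -> 0 < x t ^ 2 + y t ^ 2) ->
  (forall t, 0 <= t <= T -> continuity_pt th1 t) ->
  (forall t, 0 <= t <= T -> continuity_pt th2 t) ->
  (forall t, 0 <= t <= T -> is_arg (th1 t) (x t) (y t)) ->
  (forall t, 0 <= t <= T -> is_arg (th2 t) (x t) (y t)) ->
  th1 T - th1 0 = th2 T - th2 0.
Proof.
  intros HT Hr Hc1 Hc2 H1 H2.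
  assert (Hd : forall t, 0 <= t <= T -> cos (th1 t - th2 t) = 1).
  { intros t Ht. apply same_arg_cos with (x t) (y t); auto. }
  assert (Hc : forall t, 0 <= t <= T -> continuity_pt (fun s => th1 s - th2 s) t).
  { intros t Ht. apply continuity_pt_minus'; auto. }
  destruct (cos_eq_1_2PI _ (Hd 0 (conj (Rle_refl 0) HT))) as [k0 Hk0].
  destruct (cos_eq_1_2PI _ (Hd T (conj HT (Rle_refl T)))) as [k1 Hk1].
  pose proof PI_RGT_0 as Hpi.
  assert (Hav : forall t, 0 <= t <= T -> th1 t - th2 t <> 2 * PI * IZR k0 + PI /\
                th1 t - th2 t <> 2 * PI * IZR k0 - PI).
  { intros t Ht; split; intros He; specialize (Hd t Ht); rewrite He in Hd.
    - rewrite neg_cos, cos_2PI_Z in Hd. lra.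
    - rewrite cos_minus, cos_2PI_Z, cos_PI, sin_PI in Hd. lra. }
  assert (Hup : th1 T - th2 T < 2 * PI * IZR k0 + PI).
  { apply (continuous_avoids_value (fun s => th1 s - th2 s) 0 T); auto.
    - intros t Ht; apply (Hav t Ht).
    - lra. }
  assert (Hlo : - (th1 T - th2 T) < - (2 * PI * IZR k0 - PI)).
  { apply (continuous_avoids_value (fun s => - (th1 s - th2 s)) 0 T); auto.
    - intros t Ht. apply continuity_pt_opp. now apply Hc.
    - intros t Ht He; apply (proj2 (Hav t Ht)). lra.
    - lra. }
  assert (k1 = k0).
  { assert (IZR k1 < IZR (k0 + 1)) by (rewrite plus_IZR; nra).
    assert (IZR (k0 - 1) < IZR k1) by (rewrite minus_IZR; nra).
    apply lt_IZR in H. apply lt_IZR in H0. lia. }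
  subst k1. lra.
Qed.

Lemma is_derive_0_const (f : R -> R) a b :
  (forall t, is_derive f t 0) -> f a = f b.
Proof.
  intros H. destruct (Rtotal_order a b) as [Hab|[->|Hab]]; [|reflexivity|].
  - apply eq_is_derive; auto.
  - symmetry. apply eq_is_derive; auto.
Qed.

Lemma is_derive_continuity_pt (f : R -> R) t l : is_derive f t l -> continuity_pt f t.
Proof.
  intros H. apply continuity_pt_filterlim.
  apply (ex_derive_continuous (V := R_NormedModule) f t). now exists l.
Qed.

(** The lift is an argument at time 0 plus the integral of the angular velocity. *)
Lemma arg_lift (x y x' y' : R -> R) :
  (forall t, is_derive x t (x' t)) -> (forall t, is_derive y t (y' t)) ->
  (forall t, continuous x' t) -> (forall t, continuous y' t) ->
  (forall t, 0 < x t ^ 2 + y t ^ 2) ->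
  exists th : R -> R,
    (forall t, is_derive th t ((x t * y' t - y t * x' t) / (x t ^ 2 + y t ^ 2))) /\
    (forall t, is_arg (th t) (x t) (y t)).
Proof.
  intros Hx Hy Cx' Cy' Hr.
  set (om := fun t => (x t * y' t - y t * x' t) / (x t ^ 2 + y t ^ 2)).
  assert (Cx : forall t, continuous x t).
  { intros t. apply (ex_derive_continuous (V := R_NormedModule)). eexists; apply Hx. }
  assert (Cy : forall t, continuous y t).
  { intros t. apply (ex_derive_continuous (V := R_NormedModule)). eexists; apply Hy. }
  assert (Com : forall t, continuous om t).
  { intros t. apply continuity_pt_filterlim.
    assert (forall f, (forall t, continuous f t) -> continuity_pt f t) as Hf
      by (intros f Hf; apply continuity_pt_filterlim, Hf).
    apply (continuity_pt_div (fun t => x t * y' t - y t * x' t)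
                             (fun t => x t ^ 2 + y t ^ 2)).
    - apply continuity_pt_minus'.
      + apply (continuity_pt_mult x y'); auto.
      + apply (continuity_pt_mult y x'); auto.
    - apply (continuity_pt_plus (fun t => x t ^ 2) (fun t => y t ^ 2)); simpl;
      repeat (apply continuity_pt_mult; auto); apply continuity_pt_const;
      intros ? ?; reflexivity.
    - specialize (Hr t). lra. }
  destruct (exists_arg (x 0) (y 0)) as [th0 [H0x H0y]].
  set (th := fun t => th0 + RInt om 0 t).
  assert (Dth : forall t, is_derive th t (om t)).
  { intros t. unfold th. evar_last.
    - apply (is_derive_plus (fun _ => th0) (fun t => RInt om 0 t)).
      + apply (is_derive_const th0).
      + apply (is_derive_RInt om (fun t => RInt om 0 t) 0).
        * apply filter_forall. intros b.
          apply (RInt_correct (V := R_CompleteNormedModule)).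
          apply ex_RInt_continuous. auto.
        * apply Com.
    - unfold plus, zero; simpl; ring. }
  exists th. split; [exact Dth|].
  set (r := fun t => sqrt (x t ^ 2 + y t ^ 2)).
  assert (Hrp : forall t, 0 < r t) by (intros t; apply sqrt_lt_R0, Hr).
  assert (Hrr : forall t, r t * r t = x t ^ 2 + y t ^ 2)
    by (intros t; apply sqrt_sqrt, Rlt_le, Hr).
  assert (Dr : forall t, is_derive r t ((x t * x' t + y t * y' t) / r t)).
  { intros t. unfold r. evar_last.
    - apply is_derive_sqrt; [|apply Hr].
      apply (is_derive_plus (fun t => x t ^ 2) (fun t => y t ^ 2));
      apply is_derive_pow; auto.
    - unfold plus; simpl. field. fold (r t). specialize (Hrp t). simpl in *.
      apply Rgt_not_eq. exact Hrp. }
  (* The component of [(x, y)] in direction [th], divided by [r], has derivative zero and equals 1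
     at time 0. *)
  assert (Hu : forall t, x t * cos (th t) + y t * sin (th t) = r t).
  { intros t.
    assert (H : (x t * cos (th t) + y t * sin (th t)) / r t = 1).
    { transitivity ((x 0 * cos (th 0) + y 0 * sin (th 0)) / r 0).
      - apply (is_derive_0_const (fun t => (x t * cos (th t) + y t * sin (th t)) / r t)).
        clear t. intros t. evar_last.
        + apply is_derive_div; [|apply Dr|apply Rgt_not_eq, Hrp].
          apply (is_derive_plus (fun t => x t * cos (th t)) (fun t => y t * sin (th t)));
          apply (is_derive_mult (K := R_AbsRing)); auto using Rmult_comm;
          (apply is_derive_comp; [|apply Dth]).
          * apply is_derive_cos.
          * apply is_derive_sin.
        + unfold plus, mult, scal, om; simpl. unfold mult; simpl.
          specialize (Hrr t). specialize (Hrp t). simpl in Hrr.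
          rewrite <- Hrr.
          apply (Rmult_eq_reg_r (r t ^ 4)); [|apply pow_nonzero; lra].
          field_simplify; [|lra].
          replace (r t ^ 2) with (x t * (x t * 1) + y t * (y t * 1)) by (rewrite <- Hrr; ring).
          replace (r t ^ 3) with (r t * (x t * (x t * 1) + y t * (y t * 1))) by (rewrite <- Hrr; ring).
          ring.
      - replace (th 0) with th0 by (unfold th; rewrite RInt_point; unfold zero; simpl; ring).
        fold (r 0) in H0x, H0y. specialize (Hrp 0). pose proof (cos2_sin2 th0) as Hcs.
        transitivity ((r 0 * (cos th0 ^ 2 + sin th0 ^ 2)) / r 0);
        [rewrite H0x, H0y at 1; field; lra | rewrite Hcs; field; lra]. }
    apply (Rmult_eq_compat_r (r t)) in H. specialize (Hrp t). unfold Rdiv in H.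
    rewrite Rmult_assoc, Rinv_l in H; lra. }
  intros t. specialize (Hu t). specialize (Hrr t). specialize (Hrp t).
  pose proof (cos2_sin2 (th t)) as Hcs.
  (* By Pythagoras nothing is left for the component orthogonal to direction [th]. *)
  assert (Hw : y t * cos (th t) - x t * sin (th t) = 0).
  { apply Rsqr_0_uniq. unfold Rsqr.
    transitivity ((x t ^ 2 + y t ^ 2) * (cos (th t) ^ 2 + sin (th t) ^ 2)
                  - (x t * cos (th t) + y t * sin (th t)) ^ 2); [ring|].
    rewrite Hcs, Hu, <- Hrr. ring. }
  apply is_arg_polar with (r t); [lra| |]; rewrite <- Hu.
  - transitivity (x t * (cos (th t) ^ 2 + sin (th t) ^ 2)
      + (y t * cos (th t) - x t * sin (th t)) * sin (th t)); [rewrite Hcs, Hw|]; ring.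
  - transitivity (y t * (cos (th t) ^ 2 + sin (th t) ^ 2)
      - (y t * cos (th t) - x t * sin (th t)) * cos (th t)); [rewrite Hcs, Hw|]; ring.
Qed.

(** * One-degree-of-freedom oscillators *)

Lemma sin_2PI_Z k : sin (2 * PI * IZR k) = 0.
Proof. apply sin_eq_0_1. exists (2 * k)%Z. rewrite mult_IZR. ring. Qed.

Lemma cos_period_Z x k : cos (x + 2 * PI * IZR k) = cos x.
Proof. rewrite cos_plus, cos_2PI_Z, sin_2PI_Z. ring. Qed.

Lemma sin_period_Z x k : sin (x + 2 * PI * IZR k) = sin x.
Proof. rewrite sin_plus, cos_2PI_Z, sin_2PI_Z. ring. Qed.

(* The sign condition says that the force [- dW] points towards [q0]; it makes the
   angle of [(q - q0, p)] strictly decreasing, and keeps [(dW q, 4p)] within a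
   right angle of that vector. *)
Lemma oscillator_rotation (dW q p : R -> R) (q0 T : R) :
  (forall t, is_derive q t (4 * p t)) ->
  (forall t, is_derive p t (- dW (q t))) ->
  (forall t, continuous (fun s => dW (q s)) t) ->
  (forall t, 0 < (q t - q0) * dW (q t) + 4 * p t ^ 2) ->
  0 < T -> q T = q 0 -> p T = p 0 ->
  exists (N : Z) (tau : R -> R),
    (1 <= N)%Z /\ (forall t, continuity_pt tau t) /\
    (forall t, is_arg (tau t) (dW (q t)) (- (4 * p t))) /\
    tau T - tau 0 = 2 * PI * IZR N.
Proof.
  intros Dq Dp CW Hpos HT HqT HpT.
  assert (Hr : forall t, 0 < (q t - q0) ^ 2 + p t ^ 2).
  { intros t. specialize (Hpos t).
    destruct (Req_dec (q t - q0) 0) as [E|]; [rewrite E in *; destruct (Req_dec (p t) 0) as [E'|]|].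
    - rewrite E' in Hpos. lra.
    - nra.
    - nra. }
  assert (Dq' : forall t, is_derive (fun s => q s - q0) t (4 * p t)).
  { intros t. evar_last.
    - apply (is_derive_minus q (fun _ => q0)); [apply Dq | apply (is_derive_const q0)].
    - unfold minus, plus, opp, zero; simpl. ring. }
  assert (Cp : forall t, continuity_pt p t)
    by (intros t; eapply is_derive_continuity_pt; apply Dp).
  assert (Cq : forall t, continuity_pt q t)
    by (intros t; eapply is_derive_continuity_pt; apply Dq).
  assert (CW' : forall t, continuity_pt (fun s => dW (q s)) t)
    by (intros t; apply continuity_pt_filterlim, CW).
  assert (Cst : forall a t, continuity_pt (fun _ => a) t)
    by (intros a t; apply continuity_pt_const; intros ? ?; reflexivity).
  destruct (arg_lift (fun t => q t - q0) p (fun t => 4 * p t) (fun t => - dW (q t)))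
    as [th [Dth Hth]]; auto.
  { intros t. apply continuity_pt_filterlim, (continuity_pt_mult (fun _ => 4) p); auto. }
  { intros t. apply continuity_pt_filterlim, (continuity_pt_opp (fun t => dW (q t))); auto. }
  assert (Cth : forall t, continuity_pt th t)
    by (intros t; eapply is_derive_continuity_pt; apply Dth).
  (* [Hpos] makes the derivative of [th] negative; the mean value theorem turns this into a strict
     loss of angle over [[0, T]]. *)
  assert (Hdec : th T < th 0).
  { destruct (MVT_gen th 0 T _ (fun x _ => Dth x) (fun x _ => Cth x)) as [x [_ Hx]].
    cut (0 < ((q x - q0) * dW (q x) + 4 * p x ^ 2) / ((q x - q0) ^ 2 + p x ^ 2) * T).
    { intros H. unfold Rdiv in *. nra. }
    apply Rmult_lt_0_compat; [apply Rdiv_lt_0_compat; auto | exact HT]. }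
  assert (Hper : cos (th 0 - th T) = 1).
  { apply same_arg_cos with (q 0 - q0) (p 0); auto.
    rewrite <- HqT, <- HpT. apply Hth. }
  destruct (cos_eq_1_2PI _ Hper) as [N HN].
  (* [cross] and [dot] are the imaginary and real parts of $\overline{(q-q_0+ip)}\,(dW+4ip)$, so
     [th + atan (cross / dot)] is an argument of [(dW q, 4p)]. Conjugation gives the minus sign,
     which turns clockwise into counterclockwise. The arctangent agrees at 0 and [T], so the total
     increment is that of [- th]. *)
  set (cross := fun t => (q t - q0) * (4 * p t) - p t * dW (q t)).
  set (dot := fun t => (q t - q0) * dW (q t) + p t * (4 * p t)).
  assert (Hdot : forall t, 0 < dot t).
  { intros t. unfold dot. specialize (Hpos t). simpl in Hpos. lra. }
  exists N, (fun t => - (th t + atan (cross t / dot t))).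
  assert (Catan : forall t, continuity_pt (fun t => atan (cross t / dot t)) t).
  { intros t. apply (continuity_pt_comp (fun t => cross t / dot t) atan).
    - assert (Cq0 : forall t, continuity_pt (fun s => q s - q0) t)
        by (intros s; apply continuity_pt_minus'; auto).
      apply (continuity_pt_div cross dot).
      + apply continuity_pt_minus'.
        * apply (continuity_pt_mult (fun s => q s - q0) (fun s => 4 * p s)); auto.
          apply (continuity_pt_mult (fun _ => 4) p); auto.
        * apply (continuity_pt_mult p (fun s => dW (q s))); auto.
      + apply (continuity_pt_plus (fun t => (q t - q0) * dW (q t)) (fun t => p t * (4 * p t))).
        * apply (continuity_pt_mult (fun s => q s - q0) (fun s => dW (q s))); auto.
        * apply (continuity_pt_mult p (fun s => 4 * p s)); auto.
          apply (continuity_pt_mult (fun _ => 4) p); auto.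
      + apply Rgt_not_eq, Hdot.
    - apply derivable_continuous_pt, derivable_pt_atan. }
  repeat split.
  - pose proof PI_RGT_0. assert (0 < IZR N) by nra. apply lt_IZR in H0. lia.
  - intros t. apply (continuity_pt_opp (fun t => th t + atan (cross t / dot t))).
    apply (continuity_pt_plus th); auto.
  - apply is_arg_conj, is_arg_acute; auto. apply Hdot.
  - apply is_arg_conj, is_arg_acute; auto. apply Hdot.
  - unfold cross, dot. rewrite HqT, HpT. lra.
Qed.

(** A continuous argument of [(cos phi, kap * sin phi)]. For [kap > 0] this vector stays within a
    right angle of [(cos phi, sin phi)], so an arctangent corrects [phi] without jumps, unlike
    [atan (kap * tan phi)]. *)
Definition ellipse_arg (kap phi : R) : R :=
  phi + atan ((cos phi * (kap * sin phi) - sin phi * cos phi) /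
              (cos phi * cos phi + sin phi * (kap * sin phi))).

Lemma ellipse_dot_pos kap phi :
  0 < kap -> 0 < cos phi * cos phi + sin phi * (kap * sin phi).
Proof.
  intros Hk. pose proof (cos2_sin2 phi) as H.
  destruct (Req_dec (sin phi) 0) as [E|E]; [rewrite E in *|]; nra.
Qed.

Lemma ellipse_argP kap phi :
  0 < kap -> is_arg (ellipse_arg kap phi) (cos phi) (kap * sin phi).
Proof.
  intros Hk. apply is_arg_acute; [now apply ellipse_dot_pos|].
  apply is_arg_polar with 1; lra.
Qed.

(** The arctangent correction is periodic. Together with monotonicity, this traps the change of
    argument between the same whole turns as the phase advance. *)
Lemma ellipse_arg_period kap phi k :
  ellipse_arg kap (phi + 2 * PI * IZR k) = ellipse_arg kap phi + 2 * PI * IZR k.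
Proof. unfold ellipse_arg. rewrite cos_period_Z, sin_period_Z. ring. Qed.

Lemma is_derive_ellipse_arg kap phi :
  0 < kap ->
  is_derive (ellipse_arg kap) phi (kap / (cos phi ^ 2 + (kap * sin phi) ^ 2)).
Proof.
  intros Hk. pose proof (ellipse_dot_pos kap phi Hk) as Hd.
  pose proof (cos2_sin2 phi) as Hcs.
  assert (Hd2 : 0 < cos phi ^ 2 + (kap * sin phi) ^ 2).
  { destruct (Req_dec (sin phi) 0) as [E|E]; [rewrite E in *; nra|].
    assert (0 < (kap * sin phi) ^ 2)
      by (apply pow2_gt_0, Rmult_integral_contrapositive; lra).
    nra. }
  unfold ellipse_arg. auto_derive; [lra|].
  set (C := cos phi) in *. set (S := sin phi) in *.
  assert (Hs : S ^ 2 = 1 - C ^ 2) by lra.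
  set (D := C * C + S * (kap * S)) in *.
  set (n := C * (kap * S) + - (S * C)).
  (* Lagrange's identity: the squared dot and cross products add up to the product of the squared
     lengths, and [(cos phi, sin phi)] has length 1. *)
  assert (HE : D ^ 2 + n ^ 2 = C ^ 2 + (kap * S) ^ 2).
  { transitivity ((C ^ 2 + S ^ 2) * (C ^ 2 + (kap * S) ^ 2)); [|rewrite Hcs; ring].
    unfold D, n. ring. }
  rewrite <- HE in *.
  match goal with |- 1 + (?n1 * / D + n * (- ?d1 * / (D * D))) * _ = _ =>
    transitivity (((D ^ 2 + n ^ 2) + (n1 * D - n * d1)) / (D ^ 2 + n ^ 2));
    [field; nra | f_equal; rewrite HE; unfold D, n] end.
  transitivity (kap * (C ^ 2 + S ^ 2) ^ 2
    + (1 - (C ^ 2 + S ^ 2)) * (C ^ 2 + (kap * S) ^ 2)); [ring | rewrite Hcs; ring].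
Qed.

Lemma ellipse_arg_incr kap a b :
  0 < kap -> a < b -> ellipse_arg kap a < ellipse_arg kap b.
Proof.
  intros Hk Hab.
  apply (incr_function (ellipse_arg kap) m_infty p_infty
           (fun phi => kap / (cos phi ^ 2 + (kap * sin phi) ^ 2))); simpl; auto.
  - intros x _ _. now apply is_derive_ellipse_arg.
  - intros x _ _. apply Rdiv_lt_0_compat; [assumption|].
    pose proof (cos2_sin2 x) as Hcs.
    destruct (Req_dec (sin x) 0) as [E|E]; [rewrite E in *; nra|].
    assert (0 < (kap * sin x) ^ 2)
      by (apply pow2_gt_0, Rmult_integral_contrapositive; lra).
    nra.
Qed.

(** With [s = sqrt k], the vector [(P, s / 2 * Q)] rotates rigidly at speed [2 * s]: [H1] and [H2]
    say that rotating it back recovers its initial value. *)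
Lemma harmonic_phase k (Q P : R -> R) :
  0 < k -> (forall t, is_derive Q t (4 * P t)) -> (forall t, is_derive P t (- k * Q t)) ->
  exists phi0 r, 0 <= r /\ forall t,
    P t = r * cos (phi0 + 2 * sqrt k * t) /\
    Q t = r * (2 / sqrt k * sin (phi0 + 2 * sqrt k * t)).
Proof.
  intros Hk DQ DP.
  pose proof (sqrt_lt_R0 _ Hk) as Hs. pose proof (sqrt_sqrt _ (Rlt_le _ _ Hk)) as Hss.
  set (s := sqrt k) in *. clearbody s.
  assert (H1 : forall t, P t * cos (2 * s * t) + s / 2 * Q t * sin (2 * s * t) = P 0).
  { intros t. transitivity (P 0 * cos (2 * s * 0) + s / 2 * Q 0 * sin (2 * s * 0)).
    - apply (is_derive_0_const (fun t => P t * cos (2 * s * t) + s / 2 * Q t * sin (2 * s * t))).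
      clear t; intros t. auto_derive.
      + repeat split; eexists; [apply DP | apply DQ].
      + replace (Derive (fun x => P x) t) with (- k * Q t)
          by (symmetry; apply is_derive_unique, DP).
        replace (Derive (fun x => Q x) t) with (4 * P t)
          by (symmetry; apply is_derive_unique, DQ).
        rewrite <- Hss. field.
    - rewrite Rmult_0_r, cos_0, sin_0. ring. }
  assert (H2 : forall t, s / 2 * Q t * cos (2 * s * t) - P t * sin (2 * s * t) = s / 2 * Q 0).
  { intros t. transitivity (s / 2 * Q 0 * cos (2 * s * 0) - P 0 * sin (2 * s * 0)).
    - apply (is_derive_0_const (fun t => s / 2 * Q t * cos (2 * s * t) - P t * sin (2 * s * t))).
      clear t; intros t. auto_derive.
      + repeat split; eexists; [apply DQ | apply DP].
      + replace (Derive (fun x => P x) t) with (- k * Q t)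
          by (symmetry; apply is_derive_unique, DP).
        replace (Derive (fun x => Q x) t) with (4 * P t)
          by (symmetry; apply is_derive_unique, DQ).
        rewrite <- Hss. field.
    - rewrite Rmult_0_r, cos_0, sin_0. ring. }
  destruct (exists_arg (P 0) (s / 2 * Q 0)) as [phi0 [HP HQ]].
  exists phi0, (sqrt (P 0 ^ 2 + (s / 2 * Q 0) ^ 2)). split; [apply sqrt_pos|].
  set (r := sqrt (P 0 ^ 2 + (s / 2 * Q 0) ^ 2)) in *. clearbody r.
  intros t. specialize (H1 t). specialize (H2 t).
  pose proof (cos2_sin2 (2 * s * t)) as Hcs.
  rewrite cos_plus, sin_plus. rewrite HP in H1. rewrite HQ in H2.
  split.
  - transitivity (P t * (cos (2 * s * t) ^ 2 + sin (2 * s * t) ^ 2)); [rewrite Hcs; ring|].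
    transitivity (r * cos phi0 * cos (2 * s * t) - r * sin phi0 * sin (2 * s * t)); [|ring].
    rewrite <- H1, <- H2. ring.
  - transitivity (Q t * (cos (2 * s * t) ^ 2 + sin (2 * s * t) ^ 2)); [rewrite Hcs; ring|].
    transitivity (2 / s * (r * sin phi0 * cos (2 * s * t) + r * cos phi0 * sin (2 * s * t))).
    + rewrite <- H1, <- H2. field. lra.
    + ring.
Qed.

(** * The linearized flow in the frame *)

(** Closed forms for the derivatives of the potentials $-2\cosh\lambda-c\cosh^2\lambda$ and
    $2(1-2\mu)\cos\nu+c\cos^2\nu$. *)
Definition dA (c l : R) : R := - sinh l * (2 + 2 * c * cosh l).
Definition dB (mu c n : R) : R := - sin n * (2 * (1 - 2 * mu) + 2 * c * cos n).
Definition d2A (c l : R) : R := - 2 * cosh l - 2 * c * (cosh l ^ 2 + sinh l ^ 2).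
Definition d2B (mu c n : R) : R :=
  - 2 * (1 - 2 * mu) * cos n - 2 * c * (cos n ^ 2 - sin n ^ 2).

Lemma is_derive_dA c l : is_derive (dA c) l (d2A c l).
Proof. unfold dA, d2A. auto_derive; [exact I | ring]. Qed.

Lemma is_derive_dB mu c n : is_derive (dB mu c) n (d2B mu c n).
Proof. unfold dB, d2B. auto_derive; [exact I | ring]. Qed.

Lemma gradK_eq mu c x :
  gradK mu c x = mkpt (dA c (lam x)) (dB mu c (nu x)) (4 * plam x) (4 * pnu x).
Proof.
  unfold gradK, Kc, dA, dB.
  f_equal; apply is_derive_unique; auto_derive; try exact I; ring.
Qed.

Lemma XK_eq mu c x :
  XK mu c x = mkpt (4 * plam x) (4 * pnu x) (- dA c (lam x)) (- dB mu c (nu x)).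
Proof. unfold XK. rewrite gradK_eq. reflexivity. Qed.

(** Because [Kc] splits, the linearized flow decouples into the [(lam, plam)] and [(nu, pnu)]
    planes. *)
Lemma DXK_eq mu c x v :
  DXK mu c x v =
  mkpt (4 * plam v) (4 * pnu v) (- d2A c (lam x) * lam v) (- d2B mu c (nu x) * nu v).
Proof.
  unfold DXK. f_equal; apply is_derive_unique;
  (eapply is_derive_ext; [intros s; rewrite XK_eq; reflexivity|]); simpl.
  - auto_derive; [exact I | ring].
  - auto_derive; [exact I | ring].
  - evar_last.
    + apply (is_derive_opp (fun s => dA c (lam x + s * lam v))).
      apply (is_derive_comp (dA c)); [apply is_derive_dA|].
      auto_derive; [exact I | reflexivity].
    + unfold opp, scal; simpl. unfold mult; simpl.
      rewrite Rmult_0_l, Rplus_0_r. ring.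
  - evar_last.
    + apply (is_derive_opp (fun s => dB mu c (nu x + s * nu v))).
      apply (is_derive_comp (dB mu c)); [apply is_derive_dB|].
      auto_derive; [exact I | reflexivity].
    + unfold opp, scal; simpl. unfold mult; simpl.
      rewrite Rmult_0_l, Rplus_0_r. ring.
Qed.

(** Orthonormality of the frame; it identifies the [z] of [winds] with the frame coordinates of the
    solution at time 0. *)
Lemma frame_dual mu c x z :
  0 < gnorm mu c x ->
  let v := padd (pscal (fst z) (frame1 mu c x)) (pscal (snd z) (frame2 mu c x)) in
  pdot (frame1 mu c x) v = fst z /\ pdot (frame2 mu c x) v = snd z.
Proof.
  intros Hg v.
  assert (Hgg : gnorm mu c x * gnorm mu c x = pdot (gradK mu c x) (gradK mu c x)).
  { unfold gnorm in *. apply sqrt_sqrt. apply Rnot_lt_le. intros H.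
    rewrite sqrt_neg_0 in Hg; lra. }
  subst v. unfold frame1, frame2. set (g := gnorm mu c x) in *.
  destruct (gradK mu c x) as [gl gn ga gb]. unfold pdot, padd, pscal in *; simpl in *.
  split; apply (Rmult_eq_reg_r (g * g)); [|nra| |nra].
  - transitivity (fst z * (gl * gl + gn * gn + ga * ga + gb * gb)); [field; lra | rewrite Hgg; ring].
  - transitivity (snd z * (gl * gl + gn * gn + ga * ga + gb * gb)); [field; lra | rewrite Hgg; ring].
Qed.

(* [(sQ, sP)] is the plane in which the linearized flow is a harmonic oscillator,
   [tau] the angle by which the frame turns relative to that plane. *)
Lemma harmonic_CZ mu c gam T (sQ sP : pt -> R) k (tau : R -> R) (N : Z) :
  0 < T -> 0 < k -> (1 <= N)%Z ->
  (forall t, continuity_pt tau t) -> tau T - tau 0 = 2 * PI * IZR N ->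
  (forall t, 0 < gnorm mu c (gam t)) ->
  (forall v, solves (fun t u => DXK mu c (gam t) u) v -> forall t,
     is_derive (fun s => sQ (v s)) t (4 * sP (v t)) /\
     is_derive (fun s => sP (v s)) t (- k * sQ (v t))) ->
  (forall t v, exists s, 0 < s /\
     pdot (frame1 mu c (gam t)) v = s * (cos (tau t) * sP v - sin (tau t) * sQ v) /\
     pdot (frame2 mu c (gam t)) v = s * (cos (tau t) * sQ v + sin (tau t) * sP v)) ->
  (exists z v, z <> (0, 0) /\ solves (fun t u => DXK mu c (gam t) u) v /\
     v 0 = padd (pscal (fst z) (frame1 mu c (gam 0))) (pscal (snd z) (frame2 mu c (gam 0)))) ->
  exists n : Z, is_CZ mu c gam T n /\ (3 <= n)%Z.
Proof.
  intros HT Hk HN Ctau Htau Hg Hlin Hproj Hex.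
  pose proof PI_RGT_0 as Hpi. pose proof (sqrt_lt_R0 _ Hk) as Hs.
  set (om := 2 * sqrt k). set (kap := 2 / sqrt k).
  assert (Hom : 0 < om) by (unfold om; lra).
  assert (Hkap : 0 < kap) by (apply Rdiv_lt_0_compat; lra).
  (* In its plane every such solution runs along an ellipse with phase [phi0 + om * t]; passing to
     the frame turns it by [tau t], so the angles add. *)
  assert (Hang : forall z v, z <> (0, 0) -> solves (fun t u => DXK mu c (gam t) u) v ->
     v 0 = padd (pscal (fst z) (frame1 mu c (gam 0))) (pscal (snd z) (frame2 mu c (gam 0))) ->
     exists phi0, forall t,
       let x := pdot (frame1 mu c (gam t)) (v t) in
       let y := pdot (frame2 mu c (gam t)) (v t) in
       0 < x ^ 2 + y ^ 2 /\ is_arg (tau t + ellipse_arg kap (phi0 + om * t)) x y).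
  { intros z v Hz Hv Hv0.
    destruct (harmonic_phase k (fun t => sQ (v t)) (fun t => sP (v t)) Hk)
      as [phi0 [r [Hr Hph]]]; try (intros t; apply (Hlin v Hv t)).
    fold om kap in Hph.
    (* Zero amplitude would make both frame coordinates vanish at time 0, forcing [z = (0, 0)]. *)
    assert (Hr0 : 0 < r).
    { destruct Hr as [|<-]; [assumption|exfalso; apply Hz].
      destruct (Hproj 0 (v 0)) as [s [_ [H1 H2]]].
      destruct (Hph 0) as [HP0 HQ0]. rewrite HP0, HQ0 in H1, H2.
      rewrite Hv0 in H1, H2.
      destruct (frame_dual mu c (gam 0) z (Hg 0)) as [E1 E2].
      rewrite E1 in H1. rewrite E2 in H2. destruct z as [z1 z2]; simpl in *.
      f_equal; lra. }
    exists phi0. intros t x y.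
    destruct (Hproj t (v t)) as [s [Hsp [H1 H2]]]. fold x in H1. fold y in H2.
    destruct (Hph t) as [HP HQ]. rewrite HP, HQ in H1, H2.
    set (ph := phi0 + om * t) in *.
    assert (Ht1 : is_arg (tau t) (cos (tau t)) (sin (tau t)))
      by (apply is_arg_polar with 1; lra).
    pose proof (is_arg_mul _ _ _ _ _ _ Ht1 (ellipse_argP kap ph Hkap)) as Hm.
    apply (is_arg_scal _ (s * r)) in Hm; [|nra].
    split.
    - rewrite H1, H2.
      replace (_ + _) with ((s * r) ^ 2 * ((cos (tau t) ^ 2 + sin (tau t) ^ 2) *
        (cos ph ^ 2 + (kap * sin ph) ^ 2))) by ring.
      rewrite cos2_sin2, Rmult_1_l. pose proof (cos2_sin2 ph).
      apply Rmult_lt_0_compat; [apply pow_lt; nra|].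
      destruct (Req_dec (sin ph) 0) as [E|E]; [rewrite E in *; nra|].
      assert (0 < (kap * sin ph) ^ 2)
        by (apply pow2_gt_0, Rmult_integral_contrapositive; lra).
      nra.
    - rewrite H1, H2.
      match type of Hm with is_arg _ ?a ?b => match goal with |- is_arg _ ?a' ?b' =>
        replace a' with a by ring; replace b' with b by ring end end.
      exact Hm. }
  assert (Cth : forall phi0 t,
      continuity_pt (fun t => tau t + ellipse_arg kap (phi0 + om * t)) t).
  { intros phi0 t. apply (continuity_pt_plus tau); [apply Ctau|].
    apply is_derive_continuity_pt with
      (om * (kap / (cos (phi0 + om * t) ^ 2 + (kap * sin (phi0 + om * t)) ^ 2))).
    apply (is_derive_comp (ellipse_arg kap) (fun t => phi0 + om * t)).
    - now apply is_derive_ellipse_arg.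
    - auto_derive; [exact I | ring]. }
  (* The number of complete turns of the phase in time [T]; whether a remainder is left decides the
     parity of the index. *)
  set (m := Int_part (om * T / (2 * PI))).
  assert (Hm : 2 * PI * IZR m <= om * T < 2 * PI * IZR m + 2 * PI).
  { destruct (base_Int_part (om * T / (2 * PI))) as [Hm1 Hm2]. fold m in Hm1, Hm2.
    assert (E : om * T = om * T / (2 * PI) * (2 * PI)) by (field; lra).
    rewrite E. split; nra. }
  assert (HomT : 0 < om * T) by now apply Rmult_lt_0_compat.
  destruct Hm as [[Hm|Hm] Hm'].
  (* The phase advance lies strictly between [m] and [m + 1] turns, whatever [phi0] is, so every
     winding lies in [(N + m, N + m + 1)]. The index is at least 3 as [N >= 1] and [m >= 0]. *)
  - exists (2 * (N + m) + 1)%Z.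
    assert (0 <= m)%Z.
    { assert (-1 < IZR m) by nra. apply lt_IZR in H. lia. }
    split; [|lia]. right. exists (N + m)%Z. split; [reflexivity|].
    intros z Hz w (v & th & Hv & Hv0 & Hc & Hth & ->).
    destruct (Hang z v Hz Hv Hv0) as [phi0 Hphi].
    assert (Hw : th T - th 0 = (tau T + ellipse_arg kap (phi0 + om * T))
                               - (tau 0 + ellipse_arg kap (phi0 + om * 0))).
    { apply (two_lifts (fun t => pdot (frame1 mu c (gam t)) (v t))
               (fun t => pdot (frame2 mu c (gam t)) (v t)) th
               (fun t => tau t + ellipse_arg kap (phi0 + om * t)) T);
      try (intros t _; apply (Hphi t)); try (intros; apply Cth); auto; lra. }
    rewrite Rmult_0_r, Rplus_0_r in Hw.
    pose proof (ellipse_arg_incr kap (phi0 + 2 * PI * IZR m) (phi0 + om * T) Hkap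
                  ltac:(lra)) as I1.
    pose proof (ellipse_arg_incr kap (phi0 + om * T) (phi0 + 2 * PI * IZR (m + 1)) Hkap
                  ltac:(rewrite plus_IZR; lra)) as I2.
    rewrite ellipse_arg_period in I1, I2. rewrite plus_IZR in *.
    split; apply (Rmult_lt_reg_r (2 * PI)); try lra;
    unfold Rdiv; rewrite (Rmult_assoc (th T - th 0)), Rinv_l by lra; lra.
  (* The phase makes exactly [m] turns, and [m >= 1] since [om * T > 0]. The even alternative of
     [is_CZ] asks for an actual solution; the one from [Hex] has winding [N + m]. *)
  - exists (2 * (N + m))%Z.
    assert (1 <= m)%Z.
    { assert (0 < IZR m) by nra. apply lt_IZR in H. lia. }
    split; [|lia]. left. exists (N + m)%Z. split; [reflexivity|].
    destruct Hex as (z & v & Hz & Hv & Hv0).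
    destruct (Hang z v Hz Hv Hv0) as [phi0 Hphi].
    exists z. split; [exact Hz|].
    exists v, (fun t => tau t + ellipse_arg kap (phi0 + om * t)).
    split; [exact Hv|]. split; [exact Hv0|]. split; [intros; apply Cth|].
    split; [intros t _; apply (Hphi t)|].
    rewrite <- Hm, ellipse_arg_period, Rmult_0_r, Rplus_0_r, plus_IZR.
    apply (Rmult_eq_reg_r (2 * PI)); [|lra].
    unfold Rdiv; rewrite (Rmult_assoc (_ - _)), Rinv_l by lra. lra.
Qed.

(* The Hamiltonian field of [A] alone, corrected by a constant multiple of [XK] to lie
   in the span of the frame at time 0, is a periodic solution of the linearized flow;
   in the frame it is a positive multiple of the conjugate of
   [(K_l + i K_a) (K_n + i K_b)]. *)
Lemma regular_torus_CZ mu c gam T N1 N2 tau1 tau2 :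
  0 <= T -> solves (fun _ x => XK mu c x) gam ->
  (1 <= N1)%Z -> (1 <= N2)%Z ->
  (forall t, continuity_pt tau1 t) -> (forall t, continuity_pt tau2 t) ->
  (forall t, is_arg (tau1 t) (dA c (lam (gam t))) (- (4 * plam (gam t)))) ->
  (forall t, is_arg (tau2 t) (dB mu c (nu (gam t))) (- (4 * pnu (gam t)))) ->
  tau1 T - tau1 0 = 2 * PI * IZR N1 -> tau2 T - tau2 0 = 2 * PI * IZR N2 ->
  0 < dA c (lam (gam 0)) ^ 2 + (4 * plam (gam 0)) ^ 2 ->
  0 < dB mu c (nu (gam 0)) ^ 2 + (4 * pnu (gam 0)) ^ 2 ->
  (forall t, 0 < gnorm mu c (gam t)) ->
  exists n : Z, is_CZ mu c gam T n /\ (3 <= n)%Z.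
Proof.
  intros HT Hsol HN1 HN2 C1 C2 A1 A2 E1 E2 P1 P2 Hg.
  pose proof PI_RGT_0 as Hpi.
  exists (2 * (N1 + N2))%Z. split; [|lia]. left. exists (N1 + N2)%Z. split; [reflexivity|].
  (* Here [xi] and [eta] are the squared moduli at time 0 of the two complex factors. *)
  set (xi := dA c (lam (gam 0)) ^ 2 + (4 * plam (gam 0)) ^ 2) in *.
  set (eta := dB mu c (nu (gam 0)) ^ 2 + (4 * pnu (gam 0)) ^ 2) in *.
  (* Since [al - be = 1], [v] below is the field of [A] plus [be] times [XK]. Since
     [al * xi + be * eta = 0], it is orthogonal to [XK] at time 0, hence in the span of the frame
     there. *)
  set (al := eta / (xi + eta)). set (be := - xi / (xi + eta)).
  set (v := fun t => mkpt (al * (4 * plam (gam t))) (be * (4 * pnu (gam t)))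
                          (al * - dA c (lam (gam t))) (be * - dB mu c (nu (gam t)))).
  assert (Hg0 : gnorm mu c (gam 0) * gnorm mu c (gam 0) = xi + eta).
  { unfold gnorm. rewrite sqrt_sqrt; rewrite gradK_eq; unfold pdot; simpl.
    - unfold xi, eta. ring.
    - nra. }
  (* The conjugate of the complex product, divided by [gnorm]. It is nonzero because the squares of
     the two numerators add up to [xi * eta]. *)
  set (z := ((dA c (lam (gam 0)) * dB mu c (nu (gam 0)) - 4 * plam (gam 0) * (4 * pnu (gam 0)))
               / gnorm mu c (gam 0),
             - (dA c (lam (gam 0)) * (4 * pnu (gam 0)) + 4 * plam (gam 0) * dB mu c (nu (gam 0)))
               / gnorm mu c (gam 0))).
  exists z. split.
  { intros Hz. injection Hz as Hz1 Hz2. specialize (Hg 0).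
    assert (0 < xi * eta) as Hp by now apply Rmult_lt_0_compat.
    unfold Rdiv in *.
    apply Rmult_integral in Hz1; destruct Hz1 as [Hz1|Hz1];
      [|pose proof (Rinv_0_lt_compat _ Hg); lra].
    apply Rmult_integral in Hz2; destruct Hz2 as [Hz2|Hz2];
      [|pose proof (Rinv_0_lt_compat _ Hg); lra].
    unfold xi, eta in Hp.
    match goal with H1 : ?a = 0, H2 : - ?b = 0 |- _ =>
      replace (_ * _) with (a ^ 2 + (- b) ^ 2) in Hp by ring;
      rewrite H1, H2 in Hp; lra end. }
  exists v, (fun t => tau1 t + tau2 t).
  (* Each block of [v] is a constant multiple of that block of the velocity of [gam], and the
     linearized equation decouples. *)
  assert (Hvsol : solves (fun t u => DXK mu c (gam t) u) v).
  { intros t. rewrite DXK_eq. unfold v; simpl.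
    destruct (Hsol t) as (D1 & D2 & D3 & D4). rewrite XK_eq in D1, D2, D3, D4.
    simpl in D1, D2, D3, D4.
    split; [|split; [|split]].
    - evar_last.
      + apply (is_derive_scal (fun t => 4 * plam (gam t))), (is_derive_scal (fun t => plam (gam t))), D3.
      + ring.
    - evar_last.
      + apply (is_derive_scal (fun t => 4 * pnu (gam t))), (is_derive_scal (fun t => pnu (gam t))), D4.
      + ring.
    - evar_last.
      + apply (is_derive_scal (fun t => - dA c (lam (gam t)))),
          (is_derive_opp (fun t => dA c (lam (gam t)))),
          (is_derive_comp (dA c) (fun t => lam (gam t))); [apply is_derive_dA | apply D1].
      + unfold opp, scal; simpl. unfold mult; simpl. ring.
    - evar_last.
      + apply (is_derive_scal (fun t => - dB mu c (nu (gam t)))),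
          (is_derive_opp (fun t => dB mu c (nu (gam t)))),
          (is_derive_comp (dB mu c) (fun t => nu (gam t))); [apply is_derive_dB | apply D2].
      + unfold opp, scal; simpl. unfold mult; simpl. ring. }
  split; [exact Hvsol|]. split; [|split; [|split]].
  - specialize (Hg 0). unfold v, z, al, be, frame1, frame2. rewrite gradK_eq.
    rewrite <- Hg0. set (g := gnorm mu c (gam 0)) in *.
    unfold padd, pscal; simpl. unfold xi, eta.
    f_equal; field; lra.
  - intros t _. apply (continuity_pt_plus tau1 tau2); auto.
  - intros t _.
    change (is_arg (tau1 t + tau2 t) (pdot (frame1 mu c (gam t)) (v t))
              (pdot (frame2 mu c (gam t)) (v t))).
    (* The [XK] part of [v] is orthogonal to the frame at every time, so only the field of [A] is
       seen and the coefficient is [al - be = 1]. *)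
    pose proof (is_arg_mul _ _ _ _ _ _ (A1 t) (A2 t)) as Hm.
    specialize (Hg t).
    apply (is_arg_scal _ (/ gnorm mu c (gam t))) in Hm;
      [|left; now apply Rinv_0_lt_compat].
    match type of Hm with is_arg _ ?a ?b => match goal with |- is_arg _ ?a' ?b' =>
      replace a' with a; [replace b' with b; [exact Hm|]|] end end;
    unfold frame1, frame2, v, al, be; rewrite gradK_eq; unfold pdot, pscal; simpl;
    field; lra.
  - rewrite plus_IZR. apply (Rmult_eq_reg_r (2 * PI)); [|lra].
    unfold Rdiv. rewrite (Rmult_assoc (_ - _)), Rinv_l by lra. lra.
Qed.

(** Supplies the explicit solution of the linearized flow when one factor is at rest. *)
Lemma harmonic_solution k :
  0 < k -> exists Q P : R -> R, Q 0 = 0 /\ P 0 = 1 /\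
    (forall t, is_derive Q t (4 * P t)) /\ (forall t, is_derive P t (- k * Q t)).
Proof.
  intros Hk. pose proof (sqrt_lt_R0 _ Hk) as Hs. pose proof (sqrt_sqrt _ (Rlt_le _ _ Hk)) as Hss.
  set (s := sqrt k) in *. clearbody s. subst k.
  exists (fun t => 2 / s * sin (2 * s * t)), (fun t => cos (2 * s * t)).
  rewrite Rmult_0_r, sin_0, cos_0.
  split; [ring|]. split; [reflexivity|]. split; intros t; auto_derive; try exact I.
  - field. lra.
  - field. lra.
Qed.

Lemma gnorm_sqr mu c x :
  gnorm mu c x * gnorm mu c x =
  dA c (lam x) ^ 2 + dB mu c (nu x) ^ 2 + (4 * plam x) ^ 2 + (4 * pnu x) ^ 2.
Proof.
  unfold gnorm. rewrite sqrt_sqrt; rewrite gradK_eq; unfold pdot; simpl; [ring | nra].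
Qed.

(** With [A] at rest the frame spans the [(lam, plam)] plane, in which the linearized flow is an
    oscillator of constant stiffness [d2A c 0 = -2 - 2 * c > 0]. The frame turns with
    [(dB, -4 * pnu)]. *)
Lemma collapsed_lam_CZ mu c gam T N tau :
  c < -1 -> 0 < T -> (1 <= N)%Z ->
  (forall t, lam (gam t) = 0 /\ plam (gam t) = 0) ->
  (forall t, continuity_pt tau t) ->
  (forall t, is_arg (tau t) (dB mu c (nu (gam t))) (- (4 * pnu (gam t)))) ->
  tau T - tau 0 = 2 * PI * IZR N ->
  (forall t, 0 < gnorm mu c (gam t)) ->
  exists n : Z, is_CZ mu c gam T n /\ (3 <= n)%Z.
Proof.
  intros Hc HT HN H0 Ctau Atau Etau Hg.
  assert (HdA : dA c 0 = 0) by (unfold dA; rewrite sinh_0; ring).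
  assert (Hk : 0 < d2A c 0) by (unfold d2A; rewrite sinh_0, cosh_0; nra).
  (* Both frame coordinates carry the opposite sign to the one [harmonic_CZ] expects for [tau]; a
     half turn absorbs it without changing the increment. *)
  apply (harmonic_CZ mu c gam T lam plam (d2A c 0) (fun t => tau t + PI) N); auto.
  - intros t. apply (continuity_pt_plus tau (fun _ => PI)); auto.
    apply continuity_pt_const; intros ? ?; reflexivity.
  - lra.
  - intros v Hv t. destruct (Hv t) as (D1 & _ & D3 & _). rewrite DXK_eq in D1, D3.
    simpl in D1, D3. rewrite (proj1 (H0 t)) in D3. now split.
  - intros t v. destruct (Atau t) as [Hx Hy]. specialize (Hg t).
    pose proof (gnorm_sqr mu c (gam t)) as Hgg.
    destruct (H0 t) as [E1 E2]. rewrite E1, E2, HdA in Hgg.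
    set (r := sqrt (dB mu c (nu (gam t)) ^ 2 + (- (4 * pnu (gam t))) ^ 2)) in *.
    exists (r / gnorm mu c (gam t)). split.
    + apply Rdiv_lt_0_compat; [|assumption]. apply sqrt_lt_R0. nra.
    + unfold frame1, frame2. rewrite gradK_eq, E1, E2, HdA.
      unfold pdot, pscal; simpl. rewrite !neg_cos, !neg_sin.
      assert (Hy' : 4 * pnu (gam t) = - (r * sin (tau t))) by lra.
      rewrite Hy', Hx. split; field; lra.
  - destruct (harmonic_solution _ Hk) as (Q & P & HQ & HP & DQ & DP).
    pose proof (gnorm_sqr mu c (gam 0)) as Hgg. specialize (Hg 0).
    destruct (H0 0) as [E1 E2]. rewrite E1, E2, HdA in Hgg.
    (* Frame coordinates of the unit vector along [plam], the initial value of the chosen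
       solution. *)
    exists (- dB mu c (nu (gam 0)) / gnorm mu c (gam 0), 4 * pnu (gam 0) / gnorm mu c (gam 0)),
      (fun t => mkpt (Q t) 0 (P t) 0). split; [|split].
    + intros Hz. injection Hz as Hz1 Hz2. unfold Rdiv in *.
      pose proof (Rinv_0_lt_compat _ Hg).
      apply Rmult_integral in Hz1; destruct Hz1 as [Hz1|Hz1]; [|lra].
      apply Rmult_integral in Hz2; destruct Hz2 as [Hz2|Hz2]; [|lra].
      rewrite Hz2 in Hgg. replace (dB mu c (nu (gam 0))) with 0 in Hgg by lra. nra.
    + intros t. rewrite DXK_eq. simpl. rewrite (proj1 (H0 t)).
      split; [apply DQ|]. split; [|split; [apply DP|]];
      (evar_last; [apply (is_derive_const 0) | unfold zero; simpl; ring]).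
    + unfold frame1, frame2. rewrite gradK_eq, E1, E2, HdA, HQ, HP.
      set (g := gnorm mu c (gam 0)) in *.
      unfold padd, pscal; simpl. f_equal; try (field; lra).
      apply (Rmult_eq_reg_r (g * g)); [|nra]. rewrite Hgg at 1. field. lra.
Qed.

(** The counterpart in the [(nu, pnu)] plane, at the rest point [n0] of [B]; here the signs fit
    [tau] without a half turn. *)
Lemma collapsed_nu_CZ mu c gam T N tau n0 :
  0 < T -> (1 <= N)%Z -> dB mu c n0 = 0 -> 0 < d2B mu c n0 ->
  (forall t, nu (gam t) = n0 /\ pnu (gam t) = 0) ->
  (forall t, continuity_pt tau t) ->
  (forall t, is_arg (tau t) (dA c (lam (gam t))) (- (4 * plam (gam t)))) ->
  tau T - tau 0 = 2 * PI * IZR N ->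
  (forall t, 0 < gnorm mu c (gam t)) ->
  exists n : Z, is_CZ mu c gam T n /\ (3 <= n)%Z.
Proof.
  intros HT HN HdB Hk H0 Ctau Atau Etau Hg.
  apply (harmonic_CZ mu c gam T nu pnu (d2B mu c n0) tau N); auto.
  - intros v Hv t. destruct (Hv t) as (_ & D2 & _ & D4). rewrite DXK_eq in D2, D4.
    simpl in D2, D4. rewrite (proj1 (H0 t)) in D4. now split.
  - intros t v. destruct (Atau t) as [Hx Hy]. specialize (Hg t).
    pose proof (gnorm_sqr mu c (gam t)) as Hgg.
    destruct (H0 t) as [E1 E2]. rewrite E1, E2, HdB in Hgg.
    set (r := sqrt (dA c (lam (gam t)) ^ 2 + (- (4 * plam (gam t))) ^ 2)) in *.
    exists (r / gnorm mu c (gam t)). split.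
    + apply Rdiv_lt_0_compat; [|assumption]. apply sqrt_lt_R0. nra.
    + unfold frame1, frame2. rewrite gradK_eq, E1, E2, HdB.
      unfold pdot, pscal; simpl.
      assert (Hy' : 4 * plam (gam t) = - (r * sin (tau t))) by lra.
      rewrite Hy', Hx. split; field; lra.
  - destruct (harmonic_solution _ Hk) as (Q & P & HQ & HP & DQ & DP).
    pose proof (gnorm_sqr mu c (gam 0)) as Hgg. specialize (Hg 0).
    destruct (H0 0) as [E1 E2]. rewrite E1, E2, HdB in Hgg.
    exists (dA c (lam (gam 0)) / gnorm mu c (gam 0), - (4 * plam (gam 0)) / gnorm mu c (gam 0)),
      (fun t => mkpt 0 (Q t) 0 (P t)). split; [|split].
    + intros Hz. injection Hz as Hz1 Hz2. unfold Rdiv in *.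
      pose proof (Rinv_0_lt_compat _ Hg).
      apply Rmult_integral in Hz1; destruct Hz1 as [Hz1|Hz1]; [|lra].
      apply Rmult_integral in Hz2; destruct Hz2 as [Hz2|Hz2]; [|lra].
      rewrite Hz1 in Hgg. replace (4 * plam (gam 0)) with 0 in Hgg by lra. nra.
    + intros t. rewrite DXK_eq. simpl. rewrite (proj1 (H0 t)).
      split; [|split; [apply DQ|split; [|apply DP]]];
      (evar_last; [apply (is_derive_const 0) | unfold zero; simpl; ring]).
    + unfold frame1, frame2. rewrite gradK_eq, E1, E2, HdB, HQ, HP.
      set (g := gnorm mu c (gam 0)) in *.
      unfold padd, pscal; simpl. f_equal; try (field; lra).
      apply (Rmult_eq_reg_r (g * g)); [|nra]. rewrite Hgg at 1. field. lra.
Qed.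

(** * Energies and the potential wells *)

Definition EA (c : R) (x : pt) : R := 2 * plam x ^ 2 - 2 * cosh (lam x) - c * cosh (lam x) ^ 2.
Definition EB (mu c : R) (x : pt) : R :=
  2 * pnu x ^ 2 + 2 * (1 - 2 * mu) * cos (nu x) + c * cos (nu x) ^ 2.

(** Separation of variables: [lam] and [plam] evolve under [A] alone, which is therefore a second
    integral. *)
Lemma EA_conserved mu c gam s t :
  solves (fun _ x => XK mu c x) gam -> EA c (gam s) = EA c (gam t).
Proof.
  intros Hsol.
  assert (H : forall (l a : R -> R) r, is_derive l r (4 * a r) -> is_derive a r (- dA c (l r)) ->
    is_derive (fun r => 2 * a r ^ 2 - 2 * cosh (l r) - c * cosh (l r) ^ 2) r 0).
  { intros l a r Dl Da. auto_derive.
    - repeat split; eexists; eassumption.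
    - replace (Derive (fun x => a x) r) with (- dA c (l r))
        by (symmetry; now apply is_derive_unique).
      replace (Derive (fun x => l x) r) with (4 * a r)
        by (symmetry; now apply is_derive_unique).
      unfold dA. ring. }
  apply (is_derive_0_const (fun t => EA c (gam t))). clear s t; intros t.
  destruct (Hsol t) as (D1 & _ & D3 & _). rewrite XK_eq in D1, D3.
  exact (H (fun t => lam (gam t)) (fun t => plam (gam t)) t D1 D3).
Qed.

Lemma EB_conserved mu c gam s t :
  solves (fun _ x => XK mu c x) gam -> EB mu c (gam s) = EB mu c (gam t).
Proof.
  intros Hsol.
  assert (H : forall (n b : R -> R) r, is_derive n r (4 * b r) -> is_derive b r (- dB mu c (n r)) ->
    is_derive (fun r => 2 * b r ^ 2 + 2 * (1 - 2 * mu) * cos (n r) + c * cos (n r) ^ 2) r 0).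
  { intros n b r Dn Db. auto_derive.
    - repeat split; eexists; eassumption.
    - replace (Derive (fun x => b x) r) with (- dB mu c (n r))
        by (symmetry; now apply is_derive_unique).
      replace (Derive (fun x => n x) r) with (4 * b r)
        by (symmetry; now apply is_derive_unique).
      unfold dB. ring. }
  apply (is_derive_0_const (fun t => EB mu c (gam t))). clear s t; intros t.
  destruct (Hsol t) as (_ & D2 & _ & D4). rewrite XK_eq in D2, D4.
  exact (H (fun t => nu (gam t)) (fun t => pnu (gam t)) t D2 D4).
Qed.

Lemma mult_sinh_pos l : l <> 0 -> 0 < l * sinh l.
Proof.
  intros H. destruct (Rtotal_order l 0) as [Hl|[Hl|Hl]]; [|contradiction|];
  apply sinh_lt in Hl as Hl'; rewrite sinh_0 in Hl'; nra.
Qed.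

Lemma cosh_sqr l : cosh l ^ 2 = 1 + sinh l ^ 2.
Proof.
  unfold cosh, sinh.
  assert (H : exp l * exp (- l) = 1) by (rewrite <- exp_plus, Rplus_opp_r; apply exp_0).
  lra.
Qed.

Lemma cosh_ge_1 l : 1 <= cosh l.
Proof.
  assert (0 < cosh l) by (unfold cosh; pose proof (exp_pos l); pose proof (exp_pos (- l)); lra).
  pose proof (cosh_sqr l). nra.
Qed.

Lemma dA_restoring c l : c < -1 -> l <> 0 -> 0 < l * dA c l.
Proof.
  intros Hc Hl. pose proof (mult_sinh_pos l Hl). pose proof (cosh_ge_1 l).
  unfold dA. replace (_ * _) with ((l * sinh l) * - (2 + 2 * c * cosh l)) by ring.
  apply Rmult_lt_0_compat; [assumption | nra].
Qed.

(** With [y = cosh (lam x)], the excess over the rest energy is [2 * plam x ^ 2 + (y - 1) * (-2 - c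
    * (y + 1))], whose last factor is positive for [y >= 1]. *)
Lemma EA_min c x : c < -1 -> -2 - c <= EA c x.
Proof.
  intros Hc. unfold EA. pose proof (cosh_ge_1 (lam x)). set (y := cosh (lam x)) in *.
  assert (0 <= (y - 1) * (-2 - c * (y + 1))) by (apply Rmult_le_pos; nra). nra.
Qed.

Lemma EA_eq_min c x : c < -1 -> EA c x = -2 - c -> lam x = 0 /\ plam x = 0.
Proof.
  intros Hc H. unfold EA in H. pose proof (cosh_ge_1 (lam x)) as Hy.
  pose proof (cosh_sqr (lam x)) as Hs. set (y := cosh (lam x)) in *.
  assert (Hm : 0 <= (y - 1) * (-2 - c * (y + 1))) by (apply Rmult_le_pos; nra).
  assert (Hp : plam x = 0) by (apply Rsqr_0_uniq; unfold Rsqr; nra).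
  split; [|exact Hp]. rewrite Hp in H.
  destruct (Req_dec (lam x) 0) as [|Hl]; [assumption|exfalso].
  pose proof (mult_sinh_pos _ Hl) as Hsl.
  assert (sinh (lam x) <> 0) by (intros E; rewrite E in Hsl; lra).
  assert (1 < y) by nra.
  assert (0 < (y - 1) * (-2 - c * (y + 1))) by (apply Rmult_lt_0_compat; nra). nra.
Qed.

Lemma continuous_stays_below (f : R -> R) y s t :
  (forall t, continuity_pt f t) -> (forall t, f t <> y) -> f s < y -> f t < y.
Proof.
  intros Hc Hy Hs. destruct (Rle_lt_dec s t) as [Hst|Hst].
  - apply (continuous_avoids_value f s t); auto.
  - destruct (Rtotal_order (f t) y) as [|[H|H]]; [assumption | now apply Hy in H | exfalso].
    assert (- f s < - y); [|lra].
    apply (continuous_avoids_value (fun r => - f r) t s); [lra| | |lra].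
    + intros r _. apply (continuity_pt_opp f), Hc.
    + intros r _ E. apply (Hy r). lra.
Qed.

Lemma restoring_nonzero d a p : 0 < d * a + 4 * p ^ 2 -> 0 < a ^ 2 + (4 * p) ^ 2.
Proof.
  intros H. destruct (Req_dec p 0) as [->|]; [|nra].
  assert (a <> 0) by (intros ->; lra). nra.
Qed.

Lemma mult_sin_pos d : - PI < d < PI -> d <> 0 -> 0 < d * sin d.
Proof.
  intros Hd H0. destruct (Rtotal_order d 0) as [H|[H|H]]; [|contradiction|].
  - pose proof (sin_lt_0_var d). nra.
  - pose proof (sin_gt_0 d). nra.
Qed.

(** Squaring $c+1<-2\sqrt{\mu(1-\mu)}$ gives $(c+1)^2>1-(1-2\mu)^2$. The second inequality says that
    the maximum $-(1-2\mu)^2/c$ of the [nu] potential exceeds [2 + c], the largest energy available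
    to [B]. *)
Lemma critical_energy mu c :
  0 < mu <= 1 / 2 -> c < cJ mu -> c < -1 /\ 0 < c ^ 2 + 2 * c + (1 - 2 * mu) ^ 2.
Proof.
  unfold cJ. intros Hmu Hc.
  assert (Hw : 0 < mu * (1 - mu)) by nra.
  pose proof (sqrt_lt_R0 _ Hw). pose proof (sqrt_sqrt _ (Rlt_le _ _ Hw)).
  split; nra.
Qed.

(* [nu] cannot pass a maximum of the potential, where [(1 - 2 mu) + c cos nu = 0]; it is
   confined to the well around a multiple [n0] of [PI], within distance [PI]. *)
Lemma nu_well mu c gam :
  0 < mu <= 1 / 2 -> c < cJ mu -> Kpt mu c (gam 0) = 0 ->
  solves (fun _ x => XK mu c x) gam ->
  exists n0 s, cos n0 = s /\ sin n0 = 0 /\ s ^ 2 = 1 /\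
    forall t, - PI < nu (gam t) - n0 < PI /\
              s * ((1 - 2 * mu) + c * cos (nu (gam t))) < 0.
Proof.
  intros Hmu HcJ HK Hsol. destruct (critical_energy mu c Hmu HcJ) as [Hc Hcrit].
  pose proof PI_RGT_0 as Hpi.
  assert (Cnu : forall t, continuity_pt (fun t => nu (gam t)) t).
  { intros t. destruct (Hsol t) as (_ & D & _).
    exact (is_derive_continuity_pt (fun t => nu (gam t)) t _ D). }
  set (F := fun t => (1 - 2 * mu) + c * cos (nu (gam t))).
  assert (CF : forall t, continuity_pt F t).
  { intros t. apply (continuity_pt_plus (fun _ => 1 - 2 * mu)).
    - apply continuity_pt_const; intros ? ?; reflexivity.
    - apply (continuity_pt_mult (fun _ => c)).
      + apply continuity_pt_const; intros ? ?; reflexivity.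
      + apply (continuity_pt_comp (fun t => nu (gam t)) cos); [apply Cnu|].
        apply continuity_cos. }
  (* [EB <= 2 + c] because [EA >= -2 - c] and the two sum to zero. Multiplying by [c < 0] and
     inserting [c * y = - (1 - 2 * mu)] contradicts [Hcrit]. *)
  assert (HF : forall t, F t <> 0).
  { intros t Ht. unfold F in Ht.
    assert (HE : EB mu c (gam t) <= 2 + c).
    { rewrite (EB_conserved mu c gam t 0 Hsol). pose proof (EA_min c (gam 0) Hc).
      unfold Kpt, Kc in HK. unfold EA, EB in *. lra. }
    unfold EB in HE. set (y := cos (nu (gam t))) in *. set (b := pnu (gam t)) in *.
    assert (Hy : c * y = - (1 - 2 * mu)) by lra.
    assert (H : c * (2 * b ^ 2 + 2 * (1 - 2 * mu) * y + c * y ^ 2) >= c * (2 + c)) by nra.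
    replace (c * _) with (2 * c * b ^ 2 + 2 * (1 - 2 * mu) * (c * y) + (c * y) ^ 2) in H at 1 by ring.
    rewrite Hy in H. assert (c * b ^ 2 <= 0) by nra. nra. }
  (* [delta] selects the component of the energy surface: 0 for the one around $M$, [PI] for the one
     around $E$. *)
  assert (Hdelta : exists delta, cos delta ^ 2 = 1 /\ sin delta = 0 /\
                     forall t, cos delta * F t < 0).
  { destruct (Rtotal_order (F 0) 0) as [H|[H|H]]; [|now apply HF in H|].
    - exists 0. rewrite cos_0, sin_0. split; [ring|]. split; [reflexivity|].
      intros t. pose proof (continuous_stays_below F 0 0 t CF HF H). lra.
    - exists PI. rewrite cos_PI, sin_PI. split; [ring|]. split; [reflexivity|].
      intros t. pose proof (continuous_stays_below (fun t => - F t) 0 0 t) as Hb.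
      cut (- F t < 0); [lra|]. apply Hb; [| |lra].
      + intros r. apply (continuity_pt_opp F), CF.
      + intros r E. apply (HF r). lra. }
  destruct Hdelta as (delta & Hs & Hsd & HFs).
  (* Chosen so that [nu (gam 0)] lies in [[n0 - PI, n0 + PI)]; the closed left end is excluded
     afterwards by [Havm]. *)
  set (k := Int_part ((nu (gam 0) + PI - delta) / (2 * PI))).
  set (n0 := delta + 2 * PI * IZR k).
  exists n0, (cos delta).
  assert (Hn0 : cos n0 = cos delta) by apply cos_period_Z.
  assert (Hn0s : sin n0 = 0) by (unfold n0; rewrite sin_period_Z; exact Hsd).
  split; [exact Hn0|]. split; [exact Hn0s|]. split; [exact Hs|].
  (* at [n0 + PI] and [n0 - PI] the sign condition would fail *)
  assert (Hopp : forall t, cos (nu (gam t)) <> - cos delta).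
  { intros t E. specialize (HFs t). unfold F in HFs. rewrite E in HFs.
    assert (-1 <= cos delta <= 1) by apply COS_bound. nra. }
  assert (Havp : forall t, nu (gam t) <> n0 + PI).
  { intros t E. apply (Hopp t). rewrite E, neg_cos, Hn0. reflexivity. }
  assert (Havm : forall t, nu (gam t) <> n0 - PI).
  { intros t E. apply (Hopp t). rewrite E, cos_minus, cos_PI, sin_PI, Hn0. ring. }
  assert (H0 : n0 - PI <= nu (gam 0) < n0 + PI).
  { destruct (base_Int_part ((nu (gam 0) + PI - delta) / (2 * PI))) as [Hk1 Hk2].
    fold k in Hk1, Hk2. unfold n0.
    assert (E : nu (gam 0) + PI - delta = (nu (gam 0) + PI - delta) / (2 * PI) * (2 * PI))
      by (field; lra).
    set (X := (nu (gam 0) + PI - delta) / (2 * PI)) in *. split; nra. }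
  intros t. split; [|apply HFs].
  pose proof (continuous_stays_below (fun t => nu (gam t)) (n0 + PI) 0 t Cnu Havp (proj2 H0)).
  assert (- nu (gam t) < - (n0 - PI)).
  { apply (continuous_stays_below (fun t => - nu (gam t)) (- (n0 - PI)) 0 t).
    - intros r. apply (continuity_pt_opp (fun t => nu (gam t))), Cnu.
    - intros r E. apply (Havm r). lra.
    - specialize (Havm 0). lra. }
  lra.
Qed.

(** * Rest states of the two factors and the three types of periodic orbits *)

Theorem mainTheorem3 (mu c : R) :
  0 < mu <= 1 / 2 -> c < cJ mu ->
  forall (gam : R -> pt) (T : R), periodic_orbit mu c gam T ->
  exists n : Z, is_CZ mu c gam T n /\ (3 <= n)%Z.
Proof.
  intros Hmu HcJ gam T (HT & HK & Hper & Hsol).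
  destruct (critical_energy mu c Hmu HcJ) as [Hc _].
  destruct (nu_well mu c gam Hmu HcJ HK Hsol) as (n0 & s & Hcn & Hsn & Hs2 & Hwell).
  assert (Hs1 : s = 1 \/ s = -1).
  { destruct (Req_dec s 1) as [|H]; [now left | right].
    apply (Rmult_eq_reg_l (s - 1)); [nra | lra]. }
  assert (HdB0 : dB mu c n0 = 0) by (unfold dB; rewrite Hsn; ring).
  (* The value is [-2 * (1 - 2 * mu) * s - 2 * c], positive because [1 - 2 * mu < 1 < - c]. *)
  assert (Hd2B : 0 < d2B mu c n0).
  { unfold d2B. rewrite Hsn, Hcn. destruct Hs1 as [-> | ->]; nra. }
  assert (HdA0 : dA c 0 = 0) by (unfold dA; rewrite sinh_0; ring).
  assert (Hrel : forall t, sin (nu (gam t)) = s * sin (nu (gam t) - n0) /\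
                           cos (nu (gam t)) = s * cos (nu (gam t) - n0)).
  { intros t. replace (nu (gam t)) with (n0 + (nu (gam t) - n0)) at 1 3 by ring.
    rewrite sin_plus, cos_plus, Hsn, Hcn. split; ring. }
  assert (HdB : forall t, nu (gam t) <> n0 -> 0 < (nu (gam t) - n0) * dB mu c (nu (gam t))).
  { intros t Hn. destruct (Hwell t) as [Hd HF].
    pose proof (mult_sin_pos (nu (gam t) - n0) Hd ltac:(lra)) as Hds.
    unfold dB. rewrite (proj1 (Hrel t)).
    replace (_ * _) with (((nu (gam t) - n0) * sin (nu (gam t) - n0)) *
      (-2 * (s * ((1 - 2 * mu) + c * cos (nu (gam t)))))) by ring.
    apply Rmult_lt_0_compat; lra. }
  (* The excess of [EB] over the bottom of the well is [2 * pnu ^ 2] plus [1 - cos (nu - n0)] times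
     a factor that the well condition makes positive. Equality forces the cosine to be 1, and
     confinement within [PI] of [n0] leaves only [n0]. *)
  assert (HBmin : forall t, EB mu c (gam t) = 2 * (1 - 2 * mu) * s + c ->
                            nu (gam t) = n0 /\ pnu (gam t) = 0).
  { intros t HE. destruct (Hwell t) as [Hd HF].
    destruct (Hrel t) as [_ Hcos]. unfold EB in HE.
    set (y := cos (nu (gam t))) in *. set (m := 1 - 2 * mu) in *.
    set (z := cos (nu (gam t) - n0)) in *.
    assert (Hz : z = s * y) by (rewrite Hcos; replace (s * (s * z)) with (s ^ 2 * z) by ring;
                                rewrite Hs2; ring).
    assert (Hz1 : z <= 1) by apply COS_bound.
    assert (Hneg : s * (m + c * y) + (s * m + c) < 0)
      by (subst m; destruct Hs1 as [-> | ->]; nra).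
    assert (HE' : 2 * pnu (gam t) ^ 2 + (1 - z) * - (s * (m + c * y) + (s * m + c)) = 0).
    { rewrite Hz. replace (2 * m * s + c) with (2 * m * s + c * s ^ 2) in HE by (rewrite Hs2; ring).
      transitivity ((2 * pnu (gam t) ^ 2 + 2 * m * y + c * y ^ 2) - (2 * m * s + c * s ^ 2)
        + (s ^ 2 - 1) * (2 * m * y + c * y ^ 2 + c)); [ring | rewrite HE, Hs2; ring]. }
    assert (0 <= (1 - z) * - (s * (m + c * y) + (s * m + c))) by (apply Rmult_le_pos; lra).
    assert (Hp : pnu (gam t) = 0) by (apply Rsqr_0_uniq; unfold Rsqr; nra).
    split; [|exact Hp]. rewrite Hp in HE'.
    assert (z = 1) by nra.
    destruct (Req_dec (nu (gam t)) n0) as [|Hn]; [assumption|exfalso].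
    pose proof (mult_sin_pos (nu (gam t) - n0) Hd ltac:(lra)) as Hds.
    pose proof (cos2_sin2 (nu (gam t) - n0)) as Hcs. fold z in Hcs.
    rewrite H0 in Hcs. assert (sin (nu (gam t) - n0) = 0) by (apply Rsqr_0_uniq; unfold Rsqr; nra).
    nra. }
  assert (HK' : forall t, EA c (gam t) + EB mu c (gam t) = 0).
  { intros t. rewrite (EA_conserved mu c gam t 0 Hsol), (EB_conserved mu c gam t 0 Hsol).
    unfold Kpt, Kc in HK. unfold EA, EB. lra. }
  (* The two rest energies sum to [2 * (1 - 2 * mu) * s - 2 < 0], whereas the orbit has total energy
     0. *)
  assert (Hnot_eq : forall t, ~ (lam (gam t) = 0 /\ plam (gam t) = 0 /\
                                 nu (gam t) = n0 /\ pnu (gam t) = 0)).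
  { intros t (E1 & E2 & E3 & E4). specialize (HK' t). unfold EA, EB in HK'.
    rewrite E1, E2, E3, E4, cosh_0, Hcn in HK'. destruct Hs1 as [-> | ->]; lra. }
  assert (HA : forall t, ~ (lam (gam t) = 0 /\ plam (gam t) = 0) ->
            0 < (lam (gam t) - 0) * dA c (lam (gam t)) + 4 * plam (gam t) ^ 2).
  { intros t Hn. rewrite Rminus_0_r. destruct (Req_dec (lam (gam t)) 0) as [E|E].
    - rewrite E. assert (plam (gam t) <> 0) by tauto. nra.
    - pose proof (dA_restoring c _ Hc E). nra. }
  assert (HB : forall t, ~ (nu (gam t) = n0 /\ pnu (gam t) = 0) ->
            0 < (nu (gam t) - n0) * dB mu c (nu (gam t)) + 4 * pnu (gam t) ^ 2).
  { intros t Hn. destruct (Req_dec (nu (gam t)) n0) as [E|E].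
    - rewrite E. assert (pnu (gam t) <> 0) by tauto. nra.
    - pose proof (HdB t E). nra. }
  (* A vanishing gradient would put both factors at rest at once. *)
  assert (Hg : forall t, 0 < gnorm mu c (gam t)).
  { intros t. destruct (sqrt_pos (pdot (gradK mu c (gam t)) (gradK mu c (gam t)))) as [|E];
      [assumption|exfalso].
    pose proof (gnorm_sqr mu c (gam t)) as Hgg. unfold gnorm in Hgg. rewrite <- E in Hgg.
    pose proof (fun H => restoring_nonzero _ _ _ (HA t H)).
    pose proof (fun H => restoring_nonzero _ _ _ (HB t H)).
    apply (Hnot_eq t).
    destruct (Classical_Prop.classic (lam (gam t) = 0 /\ plam (gam t) = 0)) as [H1|H1];
    destruct (Classical_Prop.classic (nu (gam t) = n0 /\ pnu (gam t) = 0)) as [H2|H2];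
    [tauto| | |]; exfalso; try specialize (H H1); try specialize (H0 H2); nra. }
  assert (D : forall t, is_derive (fun t => lam (gam t)) t (4 * plam (gam t)) /\
            is_derive (fun t => nu (gam t)) t (4 * pnu (gam t)) /\
            is_derive (fun t => plam (gam t)) t (- dA c (lam (gam t))) /\
            is_derive (fun t => pnu (gam t)) t (- dB mu c (nu (gam t)))).
  { intros t. destruct (Hsol t) as (D1 & D2 & D3 & D4). rewrite XK_eq in D1, D2, D3, D4.
    exact (conj D1 (conj D2 (conj D3 D4))). }
  assert (HrotA : (forall t, ~ (lam (gam t) = 0 /\ plam (gam t) = 0)) ->
    exists (N : Z) (tau : R -> R), (1 <= N)%Z /\ (forall t, continuity_pt tau t) /\
    (forall t, is_arg (tau t) (dA c (lam (gam t))) (- (4 * plam (gam t)))) /\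
    tau T - tau 0 = 2 * PI * IZR N).
  { intros Hn. apply (oscillator_rotation (dA c) (fun t => lam (gam t)) (fun t => plam (gam t)) 0);
      try (intros t; apply (D t)); auto; try (now rewrite Hper).
    intros t. apply (ex_derive_continuous (V := R_NormedModule) (fun s => dA c (lam (gam s)))).
    eexists. exact (is_derive_comp (dA c) _ t _ _ (is_derive_dA _ _) (proj1 (D t))). }
  assert (HrotB : (forall t, ~ (nu (gam t) = n0 /\ pnu (gam t) = 0)) ->
    exists (N : Z) (tau : R -> R), (1 <= N)%Z /\ (forall t, continuity_pt tau t) /\
    (forall t, is_arg (tau t) (dB mu c (nu (gam t))) (- (4 * pnu (gam t)))) /\
    tau T - tau 0 = 2 * PI * IZR N).
  { intros Hn. apply (oscillator_rotation (dB mu c) (fun t => nu (gam t)) (fun t => pnu (gam t)) n0);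
      try (intros t; apply (D t)); auto; try (now rewrite Hper).
    intros t. apply (ex_derive_continuous (V := R_NormedModule) (fun s => dB mu c (nu (gam s)))).
    eexists. exact (is_derive_comp (dB mu c) _ t _ _ (is_derive_dB _ _ _) (proj1 (proj2 (D t)))). }
  (* By conservation a factor is at rest either for all time or never, so comparing its energy at
     time 0 with the rest energy decides the case. *)
  destruct (Req_dec (EA c (gam 0)) (-2 - c)) as [EA0|EA0].
  - assert (HA0 : forall t, lam (gam t) = 0 /\ plam (gam t) = 0).
    { intros t. apply (EA_eq_min c); [exact Hc|].
      now rewrite (EA_conserved mu c gam t 0 Hsol). }
    destruct HrotB as (N & tau & HN & Ctau & Atau & Etau).
    { intros t Hn. apply (Hnot_eq t). destruct (HA0 t). tauto. }
    now apply (collapsed_lam_CZ mu c gam T N tau).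
  - destruct HrotA as (N1 & tau1 & HN1 & Ctau1 & Atau1 & Etau1).
    { intros t [E1 E2]. apply EA0. rewrite (EA_conserved mu c gam 0 t Hsol).
      unfold EA. rewrite E1, E2, cosh_0. ring. }
    destruct (Req_dec (EB mu c (gam 0)) (2 * (1 - 2 * mu) * s + c)) as [EB0|EB0].
    + apply (collapsed_nu_CZ mu c gam T N1 tau1 n0); auto.
      intros t. apply HBmin. now rewrite (EB_conserved mu c gam t 0 Hsol).
    + assert (HnB : forall t, ~ (nu (gam t) = n0 /\ pnu (gam t) = 0)).
      { intros t [E1 E2]. apply EB0. rewrite (EB_conserved mu c gam 0 t Hsol).
        unfold EB. rewrite E1, E2, Hcn, Hs2. ring. }
      destruct (HrotB HnB) as (N2 & tau2 & HN2 & Ctau2 & Atau2 & Etau2).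
      apply (regular_torus_CZ mu c gam T N1 N2 tau1 tau2); auto; try lra.
      * apply (restoring_nonzero (lam (gam 0) - 0)), HA. intros [E1 E2].
        apply EA0. unfold EA. rewrite E1, E2, cosh_0. ring.
      * apply (restoring_nonzero (nu (gam 0) - n0)), HB, HnB.
Qed.
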